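(* Let $k$ be a positive integer. If $T$ is a finite tree with $\operatorname{diam}(T) \geq 2k-1$, then $c_{H,k}(T) \leq 2$.
   Context: The $k$-hyperopic game of cops and robber ($k \ge 1$ an integer) on a finite connected simple graph $G$ is played by a team of cops (controlled by one player) and one robber, all occupying vertices of $G$. First the cops choose their starting vertices (several cops may share a vertex), then the robber chooses his starting vertex. Then the players alternate turns, cops first: on the cops' turn each cop stays or moves to an adjacent vertex; on the robber's turn he stays or moves to an adjacent vertex. The robber always sees the positions of all cops. The robber is invisible to the cops whenever every cop satisfies $1 \le d(r,c) \le k$, where $r$ and $c$ are the current positions of the robber and that cop and $d$ is graph distance; otherwise (in particular whenever some cop is at distance greater than $k$ from him) his position is known to all cops. The robber is omniscient: he knows the complete strategy of the cops in advance, so he is never captured by chance, i.e. a winning cop strategy must guarantee capture against every possible play of the robber. The cops win if after finitely many rounds some cop occupies the same vertex as the robber; otherwise the robber wins. The $k$-hyperopic cop number $c_{H,k}(G)$ is the minimum number of cops that have a winning strategy on $G$. The diameter $\operatorname{diam}(G)$ is the maximum distance between two vertices of $G$. *)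

(* Defs.v *)
From mathcomp Require Import all_boot.
From mathcomp Require Import boolp.

Set Implicit Arguments.
Unset Strict Implicit.
Unset Printing Implicit Defensive.

(* A finite simple graph is a symmetric irreflexive relation [e] on a finite
   type [T]. *)

Section Graphs.
Variables (T : finType) (e : rel T).

(* The clause [2 < size c] is needed because [:: x; y] is a [ucycle] for every
   edge xy. *)
Definition acyclic : Prop := forall c : seq T, 2 < size c -> ~ ucycle e c.

Definition is_tree : Prop :=
  [/\ symmetric e, irreflexive e, 0 < #|T|, forall x y, connect e x y
    & acyclic].

Definition walk_of_length (x y : T) (n : nat) : bool :=
  [exists p : n.-tuple T, path e x p && (last x p == y)].

(* Least length of a walk from x to y; a shortest walk has length less than
   #|T|, and the junk value #|T| is taken only when x and y are not
   connected. *)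
Definition dist (x y : T) : nat := find (walk_of_length x y) (iota 0 #|T|).

Definition diam : nat := \max_(x : T) \max_(y : T) dist x y.

Definition step (x y : T) : bool := (x == y) || e x y.

End Graphs.

Section HyperopicGame.
Variables (k : nat) (T : finType) (e : rel T).

Definition invisible n (c : {ffun 'I_n -> T}) (r : T) : bool :=
  [forall i, 1 <= dist e r (c i) <= k].

Definition observe n (c : {ffun 'I_n -> T}) (r : T) : option T :=
  if invisible c r then None else Some r.

(* A strategy maps the chronological list of everything observed so far to the
   next positions of the cops; its value at [::] is the initial placement. The
   cops' own past positions are determined by the strategy and the
   observations. *)
Definition strategy n := seq (option T) -> {ffun 'I_n -> T}.

Section Play.
Variables (n : nat) (s : strategy n) (r : nat -> T).

(* [r t] is the robber's position after t rounds. The cops observe after the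
   initial placements and then after every turn, i.e. twice per round: once
   when they have moved and once when the robber has answered. *)
Fixpoint history (t : nat) : seq (option T) :=
  if t is t'.+1 then
    let h := history t' in
    h ++ [:: observe (s h) (r t'); observe (s h) (r t)]
  else [:: observe (s [::]) (r 0)].

Definition cops_at (t : nat) : {ffun 'I_n -> T} :=
  if t is t'.+1 then s (history t') else s [::].

(* The second disjunct is a capture on the cops' turn of round t + 1, the first
   one a capture at the start (t = 0) or on the robber's turn of round t. *)
Definition captured_at (t : nat) : Prop :=
  exists i, cops_at t i = r t \/ cops_at t.+1 i = r t.

End Play.

Definition robber_walk (r : nat -> T) : Prop := forall t, step e (r t) (r t.+1).

Definition legal n (s : strategy n) : Prop :=
  forall r, robber_walk r ->
  forall t i, step e (cops_at s r t i) (cops_at s r t.+1 i).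

(* Since strategies are deterministic, a robber who knows the strategy in
   advance is modelled by quantifying over all of his trajectories. *)
Definition winning n (s : strategy n) : Prop :=
  forall r, robber_walk r -> exists t, captured_at s r t.

Definition cops_win (n : nat) : Prop :=
  exists s : strategy n, legal s /\ winning s.

Lemma cops_win_card : cops_win #|T|.
Proof.
exists (fun _ => [ffun i => enum_val i]); split.
  by move=> r _ [|t] i; rewrite /step eqxx.
move=> r _; exists 0, (enum_rank (r 0)); left.
by rewrite ffunE enum_rankK.
Qed.

Lemma ex_cops_win : exists n, `[< cops_win n >].
Proof. by exists #|T|; apply/asboolP; exact: cops_win_card. Qed.

Definition hyperopic_cop_number : nat := ex_minn ex_cops_win.

End HyperopicGame.

(* Main.v *)
Require Import Defs.
From mathcomp Require Import all_boot.
From mathcomp Require Import boolp zify.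

Set Implicit Arguments.
Unset Strict Implicit.
Unset Printing Implicit Defensive.

(** Two cops suffice because a tree of diameter at least [2k-1] has vertices
    [w], [m], [u], in this order on one path, with [d(w,m) = k] and
    [d(m,u) = k-1].  A cop at [m] cuts the tree: the robber can change from
    one branch at [m] to another only by running into that cop.  The other cop
    starts at [w].

    The basic tool is an anchored pursuit.  Let one cop, the anchor, stand
    still at [a], and let the other one stand at a vertex [c] that separates
    [a] from the robber, with [d(a,c) >= k].  Then [d(a,r) > k] as long as the
    robber is free, so he is visible; the second cop steps towards him and
    still separates him from [a].  Each such step increases [d(a,c)], so the
    pursuit ends ([pursuit_captures]).

    If [m] separates the initial position of the robber from [w], then he is
    visible and the pursuit anchored at [w] applies.  Otherwise, seen or not,
    he is in the branch of [w] at [m] and stays there while the first cop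
    waits at [m] and the second one walks from [w] to [u].  Then [m] separates
    him from [u], but [d(u,m)] is only [k-1], which is one too small for the
    pursuit.  The first cop gains the missing step blindly: the neighbour of
    [m] towards the robber is the neighbour of [m] towards [w]
    ([toward_same_branch]).

    The facts about trees behind this are [branch_neighbour_uniq], that a
    branch at [c] contains only one neighbour of [c], and its consequence
    [between_separates], that a vertex [c] other than [a] and [b] lies on the
    geodesic from [a] to [b] exactly when deleting it disconnects them. *)

(** * Distance in a connected graph *)

Section Distance.
Variables (T : finType) (e : rel T).
Hypotheses (e_sym : symmetric e) (e_conn : forall x y, connect e x y).

Local Notation d := (dist e).

Lemma walkP x y n :
  reflect (exists p, [/\ size p = n, path e x p & last x p = y])
          (walk_of_length e x y n).
Proof.
apply: (iffP existsP) => [[p /andP[xp /eqP yp]] | [p [<- xp yp]]].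
  by exists p; rewrite size_tuple.
by exists (in_tuple p); rewrite /= xp yp eqxx.
Qed.

Lemma dist_le_path x p : path e x p -> d x (last x p) <= size p.
Proof.
move=> xp; rewrite /dist leqNgt; apply/negP => lt_p.
have /(before_find 0) := lt_p.
have lt_pT : size p < #|T|.
  by apply: leq_trans lt_p _; rewrite -[leqRHS](size_iota 0) find_size.
by rewrite nth_iota // add0n => /walkP[]; exists p.
Qed.

Lemma dist_geodesic x y :
  exists p, [/\ size p = d x y, path e x p & last x p = y].
Proof.
have /connectP[p0 /shortenP[p xp Up _] ->] := e_conn x y.
(* Some walk is short enough for [dist] not to take its default value. *)
have lt_pT : size p < #|T|.
  by rewrite -[(size p).+1]/(size (x :: p)) -(card_uniqP Up) max_card.
have has_walk : has (walk_of_length e x (last x p)) (iota 0 #|T|).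
  apply/hasP; exists (size p); first by rewrite mem_iota.
  by apply/walkP; exists p.
apply/walkP; have := nth_find 0 has_walk; rewrite nth_iota //.
by move: has_walk; rewrite has_find size_iota.
Qed.

Lemma distxx x : d x x = 0.
Proof. by apply/eqP; rewrite -leqn0 (@dist_le_path x [::]). Qed.

Lemma dist_eq0 x y : d x y = 0 -> x = y.
Proof. by case: (dist_geodesic x y) => [[|z p] [<- _ <-]]. Qed.

Lemma dist_triangle y x z : d x z <= d x y + d y z.
Proof.
have [p [<- xp yp]] := dist_geodesic x y.
have [q [<- yq zq]] := dist_geodesic y z.
have := @dist_le_path x (p ++ q).
by rewrite cat_path last_cat size_cat yp zq xp yq; apply.
Qed.

Lemma dist_edge x y : e x y -> d x y <= 1.
Proof. by move=> xy; rewrite (@dist_le_path x [:: y]) //= xy. Qed.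

Lemma dist_sym x y : d x y = d y x.
Proof.
suff le_d a b : d a b <= d b a by apply/eqP; rewrite eqn_leq !le_d.
have [p [<- bp ap]] := dist_geodesic b a.
have := @dist_le_path a (rev (belast b p)).
rewrite -{1 2}ap rev_path size_rev size_belast.
rewrite (eq_path (e' := e)) // bp => /(_ isT).
by case: p ap {bp} => [|c p] /= <- //; rewrite rev_cons last_rcons.
Qed.

Lemma dist_lt_card x y : d x y < #|T|.
Proof.
have /connectP[p0 /shortenP[p xp Up _] ->] := e_conn x y.
apply: leq_ltn_trans (dist_le_path xp) _.
by rewrite -[(size p).+1]/(size (x :: p)) -(card_uniqP Up) max_card.
Qed.

(** ** Moving towards a vertex *)

Definition toward (c r : T) : T :=
  odflt c [pick x | e c x && (d x r < d c r)].

Lemma step_toward c r : step e c (toward c r).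
Proof.
by rewrite /step /toward; case: pickP => [x /andP[->]|_]; rewrite ?orbT ?eqxx.
Qed.

Lemma toward_spec c r :
  r != c -> e c (toward c r) /\ (d (toward c r) r).+1 = d c r.
Proof.
move=> neq_rc; rewrite /toward; case: pickP => [x /andP[cx lt_x] | no_x] /=.
  by split=> //; have := dist_edge cx; have := dist_triangle x c r; lia.
have [p [sz_p cp rp]] := dist_geodesic c r.
case: p sz_p cp rp => [|x p] /= sz_p => [_ cr|/andP[cx xp] rp].
  by rewrite cr eqxx in neq_rc.
by have := no_x x; rewrite cx -sz_p -rp ltnS dist_le_path.
Qed.

(** * Betweenness *)

Definition between (a c b : T) : bool := d a b == d a c + d c b.

Lemma between_left a b : between a a b.
Proof. by rewrite /between distxx. Qed.

Lemma between_right a b : between a b b.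
Proof. by rewrite /between distxx addn0. Qed.

Lemma between_dist_lt a c b : between a c b -> b != c -> d a c < d a b.
Proof.
move=> /eqP-> /eqP neq_bc; rewrite -addn1 leq_add2l lt0n.
by apply/eqP => /dist_eq0 /esym.
Qed.

(** Extending a geodesic [a..c] along a geodesic to [b] cannot create a
    shortcut, so the pursuing cop stays between the anchor and his prey. *)
Lemma between_toward a c b : between a c b -> b != c ->
  between a (toward c b) b /\ d a (toward c b) = (d a c).+1.
Proof.
rewrite /between => /eqP abE neq_bc.
have [cx xb] := toward_spec neq_bc.
have := dist_edge cx; have := dist_triangle c a (toward c b).
have := dist_triangle (toward c b) a b.
by move=> *; split; lia.
Qed.

Lemma exists_between x y n :
  n <= d x y -> exists2 z, d x z = n & between x z y.
Proof.
elim: n => [|n IHn] le_n; first by exists x; rewrite ?distxx ?between_left.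
have [z xz bt_z] := IHn (ltnW le_n).
have [bt_t xt] : between x (toward z y) y /\ d x (toward z y) = (d x z).+1.
  by apply: between_toward => //; apply/eqP => yz; rewrite yz xz ltnn in le_n.
by exists (toward z y); rewrite // xt xz.
Qed.

(** ** Betweenness as separation *)

Definition avoiding (c : T) : rel T := [rel x y | [&& e x y, x != c & y != c]].

Lemma avoiding_conn_sym c : connect_sym (avoiding c).
Proof.
apply: (sym_connect_sym (e := avoiding c)) => x y.
by rewrite /avoiding /= e_sym [(x != c) && _]andbC.
Qed.

(** All vertices of a geodesic from [a] to [b] are between [a] and [b]. *)
Lemma connect_not_between a c b :
  ~~ between a c b -> connect (avoiding c) a b.
Proof.
have [n le_n] := ubnP (d b a); elim: n => // n IHn in b le_n * => nbt.
have [<-|neq_ab] := eqVneq a b; first exact: connect0.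
have [bx xa] := toward_spec neq_ab; set x := toward b a in bx xa *.
have nbt_x : ~~ between a c x.
  apply: contra nbt; rewrite /between => /eqP axE.
  have := dist_triangle x c b; have := dist_triangle c a b.
  have := dist_edge bx; rewrite !(dist_sym _ a) (dist_sym x b) in xa axE *.
  by lia.
apply: connect_trans (IHn x _ nbt_x) _; first by lia.
apply: connect1; rewrite /avoiding /= e_sym bx /=.
apply/andP; split; apply/eqP => xc.
  by rewrite xc between_right in nbt_x.
by rewrite xc between_right in nbt.
Qed.

Lemma connect_toward c b : b != c -> connect (avoiding c) b (toward c b).
Proof.
move=> neq_bc; apply: connect_not_between.
have [cx xb] := toward_spec neq_bc.
by rewrite /between (dist_sym b (toward c b)) (dist_sym b c); lia.
Qed.

(** * Trees *)

Section Tree.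
Hypothesis e_acyclic : acyclic e.

(** Otherwise a simple path between two neighbours of [c] that avoids [c]
    would close up to a cycle through [c]. *)
Lemma branch_neighbour_uniq c y z :
  e c y -> e c z -> connect (avoiding c) y z -> y = z.
Proof.
move=> cy cz /connectP[p0 /shortenP[p yp Up _] zE].
have [//|neq_yz] := eqVneq y z.
have p_gt0 : 0 < size p by case: p zE {yp Up} neq_yz => //= ->; rewrite eqxx.
have yp_e : path e y p by apply: sub_path yp => a b /andP[].
have cNp : c \notin p.
  elim: p y yp {cy zE neq_yz Up p_gt0 yp_e} => //= b p IHp y.
  by case/andP=> /and3P[_ _ neq_bc] /IHp; rewrite inE eq_sym negb_or neq_bc.
have neq_cy : c != y.
  by case: p yp p_gt0 {Up zE yp_e cNp} => //= b p /andP[/and3P[_]]; rewrite eq_sym.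
have [] := e_acyclic (c := [:: c, y & p]); first by [].
rewrite /ucycle cons_uniq Up inE negb_or neq_cy cNp /=.
by rewrite cy rcons_path yp_e -zE e_sym cz.
Qed.

Lemma between_separates a c b : a != c -> b != c ->
  between a c b = ~~ connect (avoiding c) a b.
Proof.
move=> neq_ac neq_bc; apply/idP/idP => [/eqP abE|]; last first.
  exact/contraNT/connect_not_between.
apply/negP => ab_conn.
have [cy ya] := toward_spec neq_ac.
have [cz zb] := toward_spec neq_bc.
have yz : toward c a = toward c b.
  apply: branch_neighbour_uniq cy cz _.
  apply: connect_trans (connect_trans _ ab_conn) (connect_toward neq_bc).
  by rewrite avoiding_conn_sym connect_toward.
have := dist_triangle (toward c a) a b.
rewrite {2}yz (dist_sym a (toward c a)) (dist_sym a c) in abE *.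
by lia.
Qed.

(** An edge that avoids [c] lies in one component of the tree without [c];
    so the robber cannot get past a cop at [c]. *)
Lemma between_step a c b b' : b != c -> b' != c -> step e b b' ->
  between a c b = between a c b'.
Proof.
move=> neq_bc neq_b'c /orP[/eqP->//|bb'].
have [->|neq_ac] := eqVneq a c; first by rewrite !between_left.
rewrite !between_separates //; congr (~~ _).
have bb'_conn : connect (avoiding c) b b'.
  by apply: connect1; rewrite /avoiding /= bb' neq_bc.
by rewrite (same_connect_r (avoiding_conn_sym c) bb'_conn).
Qed.

(** Two vertices separated by [c] cannot both be in the branch of [b]. *)
Lemma between_other_side a c a' b :
  between a c a' -> ~~ between a c b -> between a' c b.
Proof.
move=> bt_aa' nbt_ab; apply: contraLR bt_aa' => nbt_a'b.
rewrite between_separates ?negbK.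
- apply: connect_trans (connect_not_between nbt_ab) _.
  by rewrite avoiding_conn_sym connect_not_between.
- by apply: contraNneq nbt_ab => ->; rewrite between_left.
- by apply: contraNneq nbt_a'b => ->; rewrite between_left.
Qed.

Lemma toward_same_branch a c b :
  ~~ between a c b -> toward c a = toward c b.
Proof.
move=> nbt.
have neq_ac : a != c by apply: contraNneq nbt => ->; rewrite between_left.
have neq_bc : b != c by apply: contraNneq nbt => ->; rewrite between_right.
have [cy _] := toward_spec neq_ac.
have [cz _] := toward_spec neq_bc.
apply: branch_neighbour_uniq cy cz _.
apply: connect_trans (connect_toward neq_bc).
apply: connect_trans (connect_not_between nbt).
by rewrite avoiding_conn_sym connect_toward.
Qed.

End Tree.
End Distance.

(** * Strategies with a memory *)

Section Memory.
Variables (k : nat) (T : finType) (e : rel T) (n : nat).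
Variables (S : Type) (init : S) (update : S -> option T -> S).
Variable pos : S -> {ffun 'I_n -> T}.

(** The entries at even places, which are those observed when the cops are
    about to move. *)
Fixpoint before_cops_move (h : seq (option T)) : seq (option T) :=
  if h is o :: h' then
    o :: (if h' is _ :: h'' then before_cops_move h'' else [::])
  else [::].

Lemma before_cops_move_cat h o o' : odd (size h) ->
  before_cops_move (h ++ [:: o; o']) = rcons (before_cops_move h) o'.
Proof.
have [N] := ubnP (size h); elim: N h => // N IHN [|a [|b h]] //= lt_h.
by rewrite negbK => odd_h; rewrite IHN //; lia.
Qed.

Definition memory_strategy : strategy T n :=
  fun h => pos (foldl update init (before_cops_move h)).

Fixpoint memory (r : nat -> T) (t : nat) : S :=
  if t is t'.+1 then
    update (memory r t') (observe k e (pos (memory r t')) (r t'))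
  else init.

Lemma memory_history r t :
  foldl update init (before_cops_move (history k e memory_strategy r t)) =
  memory r t.+1.
Proof.
elim: t => [//|t IHt] /=; rewrite before_cops_move_cat ?foldl_rcons.
  by rewrite IHt {1}/memory_strategy IHt.
by elim: t {IHt} => //= t IHt; rewrite size_cat /= addn2 /= negbK.
Qed.

Lemma cops_at_memory r t : cops_at k e memory_strategy r t = pos (memory r t).
Proof. by case: t => [//|t]; rewrite /= /memory_strategy memory_history. Qed.

Definition caught (r : nat -> T) (t : nat) : Prop :=
  exists i, pos (memory r t) i = r t \/ pos (memory r t.+1) i = r t.

Lemma cops_win_memory :
  (forall q o i, step e (pos q i) (pos (update q o) i)) ->
  (forall r, robber_walk e r -> exists t, caught r t) ->
  cops_win k e n.
Proof.
move=> pos_step all_caught; exists memory_strategy; split=> [r _ t i | r r_walk].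
  by rewrite !cops_at_memory; exact: pos_step.
have [t [i caught_i]] := all_caught r r_walk.
by exists t, i; rewrite !cops_at_memory.
Qed.

End Memory.

(** * The two cops *)

Lemma diam_ge_exists (T : finType) (e : rel T) n :
  0 < n <= diam e -> exists x y, n <= dist e x y.
Proof.
case/andP=> n_gt0 le_n; apply: contrapT => no_xy.
suff : diam e <= n.-1 by lia.
apply/bigmax_leqP => x _; apply/bigmax_leqP => y _.
by rewrite leqNgt; apply/negP => lt_n; apply: no_xy; exists x, y; lia.
Qed.

(** In [Walk x] the first cop waits at [m] while the second one is at [x]; in
    [Pursue a c] the second one is the anchor, at [a], and the first one
    pursues from [c]. *)
Inductive phase (T : Type) : Type :=
| Start
| Walk of T
| Pursue of T & T.
Arguments Start {T}.

Section TwoCops.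
Variables (k : nat) (T : finType) (e : rel T) (u m w : T).
Hypotheses (treeT : is_tree e).
Hypotheses (wm : dist e w m = k) (um : (dist e u m).+1 = k).
Hypothesis bt_wmu : between e w m u.

Let e_sym : symmetric e. Proof. by case: treeT. Qed.
Let e_conn : forall x y, connect e x y. Proof. by case: treeT. Qed.
Let e_acyclic : acyclic e. Proof. by case: treeT. Qed.

Definition place (c a : T) : {ffun 'I_2 -> T} :=
  [ffun i => if i == ord0 then c else a].

Lemma placeE c a i : place c a i = if i == ord0 then c else a.
Proof. by rewrite ffunE. Qed.

Definition positions (q : phase T) : {ffun 'I_2 -> T} :=
  match q with
  | Start => place m w
  | Walk x => place m x
  | Pursue a c => place c a
  end.

Definition next_phase (q : phase T) (o : option T) : phase T :=
  match q with
  | Start =>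
      if o is Some r then
        if between e w m r then Pursue w (toward e m r) else Walk w
      else Walk w
  | Walk x =>
      if x == u then Pursue u (toward e m w) else Walk (toward e x u)
  | Pursue a c => Pursue a (if o is Some r then toward e c r else c)
  end.

Lemma positions_step q o i :
  step e (positions q i) (positions (next_phase q o) i).
Proof.
have stay x : step e x x by rewrite /step eqxx.
case: q => [|x|a c] /=.
- case: o => [r|] /=; last exact: stay.
  case: ifP => _ /=; last exact: stay.
  by rewrite !placeE; case: ifP => // _; exact: step_toward.
- case: eqP => [->|_]; rewrite !placeE; case: ifP => // _; exact: step_toward.
- rewrite !placeE; case: ifP => // _; case: o => [r|] //; exact: step_toward.
Qed.

Variable r : nat -> T.
Hypothesis r_walk : robber_walk e r.

Local Notation state := (memory k e Start next_phase positions r).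
Local Notation caught := (caught k e Start next_phase positions r).

Lemma first_cop_catches t : positions (state t) ord0 = r t -> caught t.
Proof. by exists ord0; left. Qed.

Lemma first_cop_catches_next t :
  positions (state t.+1) ord0 = r t -> caught t.
Proof. by exists ord0; right. Qed.

Lemma observe_far c a x : k < dist e a x -> observe k e (place c a) x = Some x.
Proof.
move=> far; rewrite /observe; case: ifP => // /forallP /(_ ord_max).
by rewrite placeE /= (dist_sym e_sym e_conn) [_ <= k]leqNgt far andbF.
Qed.

(** The first step towards the robber is part of the hypotheses, since the
    distance [k] from the anchor may only be reached by that step.  From then
    on the anchor sees everything beyond the pursuer, who gets one step further
    from [a] in each round; hence the induction. *)
Lemma pursuit_captures t a c :
  state t.+1 = Pursue a (toward e c (r t)) ->
  between e a c (r t) -> r t != c -> k <= (dist e a c).+1 ->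
  exists t', caught t'.
Proof.
have [N] := ubnP (#|T| - dist e a c); elim: N t c => // N IHN t c lt_N stE bt.
move=> neq_rc far; have [bt' ac'] := between_toward e_conn bt neq_rc.
set c' := toward e c (r t) in stE bt' ac'.
have [rc'|neq_rc'] := eqVneq (r t) c'.
  by exists t; apply: first_cop_catches_next; rewrite stE placeE /= rc'.
have [rSc'|neq_rSc'] := eqVneq (r t.+1) c'.
  by exists t.+1; apply: first_cop_catches; rewrite stE placeE /= rSc'.
rewrite (between_step e_sym e_conn e_acyclic a neq_rc' neq_rSc' (r_walk t)) in bt'.
apply: (IHN t.+1 c') => //.
- by have := dist_lt_card e_conn a c; lia.
- have -> : state t.+2 = next_phase (state t.+1)
      (observe k e (positions (state t.+1)) (r t.+1)) by [].
  rewrite stE [positions _]/= observe_far //.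
  by have := between_dist_lt e_conn bt' neq_rSc'; lia.
- by lia.
Qed.

Lemma walk_captures t x :
  state t = Walk x -> ~~ between e w m (r t) -> exists t', caught t'.
Proof.
have [N] := ubnP (dist e x u); elim: N t x => // N IHN t x lt_N stE nbt.
have neq_rm : r t != m.
  by apply: contraNneq nbt => ->; exact: between_right.
have : state t.+1 = if x == u then Pursue u (toward e m w)
                    else Walk (toward e x u) by rewrite /= stE.
rewrite eq_sym; have [_|neq_ux] := eqVneq u x => stSE.
  (* The first cop makes this step without seeing the robber. *)
  apply: (pursuit_captures (t := t) (a := u) (c := m)); rewrite ?um //.
    by rewrite stSE (toward_same_branch e_sym e_conn e_acyclic nbt).
  exact: (between_other_side e_sym e_conn e_acyclic bt_wmu nbt).
have [rSm|neq_rSm] := eqVneq (r t.+1) m.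
  by exists t.+1; apply: first_cop_catches; rewrite stSE placeE /= rSm.
apply: IHN stSE _; first by have [_] := toward_spec e_conn neq_ux; lia.
by rewrite -(between_step e_sym e_conn e_acyclic w neq_rm neq_rSm (r_walk t)).
Qed.

Lemma two_cops_capture : exists t, caught t.
Proof.
have [rm|neq_rm] := eqVneq (r 0) m.
  by exists 0; apply: first_cop_catches; rewrite /= placeE /= rm.
have [bt|nbt] := boolP (between e w m (r 0)).
  apply: (pursuit_captures (t := 0) (a := w) (c := m)); rewrite ?wm //=.
  rewrite observe_far ?bt //.
  by have := between_dist_lt e_conn bt neq_rm; rewrite wm.
have st1 : state 1 = Walk w.
  by rewrite /= /observe; case: ifP => //= _; rewrite (negbTE nbt).
have [rSm|neq_rSm] := eqVneq (r 1) m.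
  by exists 1; apply: first_cop_catches; rewrite st1 placeE /= rSm.
apply: walk_captures st1 _.
by rewrite -(between_step e_sym e_conn e_acyclic w neq_rm neq_rSm (r_walk 0)).
Qed.

End TwoCops.

Theorem lemma4p7 (k : nat) (T : finType) (e : rel T)
  (k_gt0 : 0 < k) (treeT : is_tree e) (diamT : 2 * k - 1 <= diam e) :
  hyperopic_cop_number k e <= 2.
Proof.
have [e_sym _ _ e_conn _] := treeT.
have bounds : 0 < 2 * k - 1 <= diam e by rewrite diamT; lia.
have [x [y le_xy]] := diam_ge_exists bounds.
have [u xu _] := exists_between e_conn le_xy.
have le_xu : k <= dist e x u by rewrite xu; lia.
have [m xm bt_xmu] := exists_between e_conn le_xu.
have um : (dist e u m).+1 = k.
  by move/eqP: bt_xmu; rewrite xu xm (dist_sym e_sym e_conn u m); lia.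
rewrite /hyperopic_cop_number; case: ex_minnP => n _ min_n.
apply/min_n/asboolP/(@cops_win_memory _ _ _ _ _ Start (next_phase e u m x)
  (positions m x)).
  exact: positions_step.
by move=> r r_walk; apply: two_cops_capture.
Qed.
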